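(* Let $p\ge 1$ be an integer and let $F\in HC_p^0$, with series expansion $$F(z)=\sum_{k=1}^{p}|z|^{2(k-1)}\sum_{j=1}^{\infty}\left(a_{k,j}z^{j}+\overline{b_{k,j}}\,\overline{z}^{\,j}\right),\qquad z\in\mathbb{U}.$$ Then the range $F(\mathbb{U})$ contains the full disk $\{w\in\mathbb{C}: |w|<1/2\}$.
   Context: $\mathbb{U}=\{z\in\mathbb{C}:|z|<1\}$. A $2p$ times continuously differentiable complex-valued mapping $F$ on a domain is polyharmonic (or $p$-harmonic) if $\Delta^pF=0$, where $\Delta=4\,\partial^2/\partial z\,\partial\overline z$. $H_p$ is the set of all polyharmonic mappings $F$ in $\mathbb{U}$ with a series expansion of the form $$F(z)=\sum_{k=1}^{p}|z|^{2(k-1)}\big(h_k(z)+\overline{g_k(z)}\big)=\sum_{k=1}^{p}|z|^{2(k-1)}\sum_{j=1}^{\infty}\left(a_{k,j}z^{j}+\overline{b_{k,j}}\,\overline{z}^{\,j}\right),$$ where $h_k(z)=\sum_{j\ge1}a_{k,j}z^j$ and $g_k(z)=\sum_{j\ge1}b_{k,j}z^j$ are analytic in $\mathbb{U}$, $a_{1,1}=1$ and $|b_{1,1}|<1$. $H_p^0$ is the subclass of $H_p$ with $b_{1,1}=0$ and $a_{k,1}=b_{k,1}=0$ for $k\in\{2,\dots,p\}$. $HS_p^0$ is the class of $F\in H_p^0$ satisfying $$\sum_{k=1}^{p}\sum_{j=1}^{\infty}\big(2(k-1)+j\big)\big(|a_{k,j}|+|b_{k,j}|\big)\le 2,$$ and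 $HC_p^0$ is the subclass of those $F\in HS_p^0$ satisfying $$\sum_{k=1}^{p}\sum_{j=1}^{\infty}\big(2(k-1)+j^{2}\big)\big(|a_{k,j}|+|b_{k,j}|\big)\le 2.$$ *)

(* Defs.v *)
From Stdlib Require Import Reals.
From Coquelicot Require Import Coquelicot.
Local Open Scope R_scope.

Definition unit_disk (z : C) : Prop := Cmod z < 1.

Definition ex_pdx (F : C -> C) (z : C) : Prop :=
  ex_derive (fun t : R => Re (F (t, Im z))) (Re z) /\
  ex_derive (fun t : R => Im (F (t, Im z))) (Re z).

Definition ex_pdy (F : C -> C) (z : C) : Prop :=
  ex_derive (fun t : R => Re (F (Re z, t))) (Im z) /\
  ex_derive (fun t : R => Im (F (Re z, t))) (Im z).

Definition pdx (F : C -> C) (z : C) : C :=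
  (Derive (fun t : R => Re (F (t, Im z))) (Re z),
   Derive (fun t : R => Im (F (t, Im z))) (Re z)).

Definition pdy (F : C -> C) (z : C) : C :=
  (Derive (fun t : R => Re (F (Re z, t))) (Im z),
   Derive (fun t : R => Im (F (Re z, t))) (Im z)).

Definition d_z (F : C -> C) (z : C) : C :=
  ((pdx F z - Ci * pdy F z) / RtoC 2)%C.

Definition d_zbar (F : C -> C) (z : C) : C :=
  ((pdx F z + Ci * pdy F z) / RtoC 2)%C.

Definition laplacian (F : C -> C) (z : C) : C :=
  (RtoC 4 * d_z (d_zbar F) z)%C.

(* Real C^n regularity, meant for open [D].  All the operators above are local,
   so the values of [F] outside [D] play no role; for [n > 0] the continuity of
   [F] itself follows from that of its first partial derivatives. *)
Fixpoint C_n_on (D : C -> Prop) (n : nat) (F : C -> C) : Prop :=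
  match n with
  | O => forall z, D z -> continuous F z
  | S m => (forall z, D z -> ex_pdx F z /\ ex_pdy F z) /\
           C_n_on D m (pdx F) /\ C_n_on D m (pdy F)
  end.

Definition polyharmonic_on (D : C -> Prop) (p : nat) (F : C -> C) : Prop :=
  C_n_on D (2 * p) F /\
  forall z, D z -> Nat.iter p laplacian F z = RtoC 0.

Definition analytic_on (D : C -> Prop) (h : C -> C) : Prop :=
  forall z, D z -> ex_derive (K := C_AbsRing) (V := C_NormedModule) h z.

(* [c j] is the coefficient of [z^j] for [j >= 1]; the entry [c 0] is unused. *)
Definition power_expansion (c : nat -> C) (h : C -> C) : Prop :=
  forall z, unit_disk z ->
    is_series (K := C_AbsRing) (V := C_NormedModule)
      (fun i => (c (S i) * z ^ S i)%C) (h z).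

Definition has_expansion (p : nat) (a b : nat -> nat -> C) (F : C -> C) : Prop :=
  exists h g : nat -> C -> C,
    (forall k, (1 <= k <= p)%nat ->
       analytic_on unit_disk (h k) /\ power_expansion (a k) (h k) /\
       analytic_on unit_disk (g k) /\ power_expansion (b k) (g k)) /\
    forall z, unit_disk z ->
      F z = sum_n_m (fun k =>
        (RtoC (Cmod z ^ (2 * (k - 1))) * (h k z + Cconj (g k z)))%C) 1 p.

(* The coefficients of an expansion are determined by [F].  Membership of [F]
   in each of the classes below is therefore stated together with its
   coefficients [a k j] and [b k j], where [1 <= k <= p] and [1 <= j]; entries
   outside this range are unconstrained. *)
Definition class_H (p : nat) (a b : nat -> nat -> C) (F : C -> C) : Prop :=
  polyharmonic_on unit_disk p F /\ has_expansion p a b F /\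
  a 1%nat 1%nat = RtoC 1 /\ Cmod (b 1%nat 1%nat) < 1.

Definition class_H0 (p : nat) (a b : nat -> nat -> C) (F : C -> C) : Prop :=
  class_H p a b F /\ b 1%nat 1%nat = RtoC 0 /\
  forall k, (2 <= k <= p)%nat ->
    a k 1%nat = RtoC 0 /\ b k 1%nat = RtoC 0.

(* [Series] is total, so a bound on the sum must assert convergence as well. *)
Definition weighted_coef_sum_le (p : nat) (weight : nat -> nat -> nat)
    (a b : nat -> nat -> C) (M : R) : Prop :=
  let term k j := INR (weight k j) * (Cmod (a k j) + Cmod (b k j)) in
  (forall k, (1 <= k <= p)%nat -> ex_series (fun i => term k (S i))) /\
  sum_n_m (fun k => Series (fun i => term k (S i))) 1 p <= M.

Definition class_HS0 (p : nat) (a b : nat -> nat -> C) (F : C -> C) : Prop :=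
  class_H0 p a b F /\
  weighted_coef_sum_le p (fun k j => 2 * (k - 1) + j)%nat a b 2.

Definition class_HC0 (p : nat) (a b : nat -> nat -> C) (F : C -> C) : Prop :=
  class_HS0 p a b F /\
  weighted_coef_sum_le p (fun k j => 2 * (k - 1) + j ^ 2)%nat a b 2.

(* Main.v *)
(** Write [F z = z + G z].  Each monomial [|z|^m z^j] of degree [n = m + j >= 2]
    is, on the disk [|z| <= r < 1], bounded by [n r^2 / 2] and Lipschitz with
    constant [n r].  The coefficient condition leaves total weight at most [1]
    for the terms of [G], so there [|G| <= r^2 / 2] and [G] is [r]-Lipschitz.
    For [|w| < 1/2] and [r = 2 |w|] the map [z |-> w - G z] is a contraction of
    the disk of radius [r] into itself, because [|w| + 2 |w|^2 <= 2 |w|]; its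
    fixed point solves [F z = w]. *)
Require Import Defs.
From Stdlib Require Import Reals Lra Lia.
From Coquelicot Require Import Coquelicot.
Local Open Scope R_scope.

(** * Modulus inequalities and Lipschitz bounds for powers *)

Lemma Cmod_minus_sym (x y : C) : Cmod (x - y) = Cmod (y - x).
Proof. rewrite <- Cmod_opp. f_equal. ring. Qed.

Lemma Cmod_minus_triangle (x y z : C) :
  Cmod (x - z) <= Cmod (x - y) + Cmod (y - z).
Proof.
  replace (x - z)%C with ((x - y) + (y - z))%C by ring. apply Cmod_triangle.
Qed.

Lemma Rabs_Cmod_minus_le (x y : C) : Rabs (Cmod x - Cmod y) <= Cmod (x - y).
Proof.
  pose proof (Cmod_triangle (x - y) y) as H1.
  pose proof (Cmod_triangle (y - x) x) as H2.
  rewrite (Cmod_minus_sym y x) in H2.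
  replace (x - y + y)%C with x in H1 by ring.
  replace (y - x + x)%C with y in H2 by ring.
  apply Rabs_le. lra.
Qed.

(** Product rule for increments: x y - x' y' = x (y - y') + (x - x') y', so a size bound is needed
    only for [x] and for [y']. *)
Lemma Cmod_mult_lip (x x' y y' : C) (X Y A B : R) :
  Cmod x <= X -> Cmod y' <= Y -> Cmod (x - x') <= A -> Cmod (y - y') <= B ->
  Cmod (x * y - x' * y') <= X * B + A * Y.
Proof.
  intros Hx Hy HA HB.
  replace (x * y - x' * y')%C with (x * (y - y') + (x - x') * y')%C by ring.
  eapply Rle_trans; [apply Cmod_triangle|]. rewrite !Cmod_mult.
  apply Rplus_le_compat; apply Rmult_le_compat; auto using Cmod_ge_0.
Qed.

(** Since x^(n+2) - y^(n+2) = x (x^(n+1) - y^(n+1)) + (x - y) y^(n+1), each induction step adds one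
    more r^(n+1) |x - y|. *)
Lemma Cpow_lip (r : R) (x y : C) (n : nat) :
  Cmod x <= r -> Cmod y <= r ->
  Cmod (x ^ S n - y ^ S n) <= INR (S n) * r ^ n * Cmod (x - y).
Proof.
  intros Hx Hy. induction n as [|n IH].
  - rewrite !Cpow_1_r. simpl. lra.
  - rewrite (Cpow_S x (S n)), (Cpow_S y (S n)).
    eapply Rle_trans.
    + apply Cmod_mult_lip with (X := r) (Y := r ^ S n);
        [exact Hx | | apply Rle_refl | exact IH].
      rewrite Cmod_pow. apply pow_incr. split; [apply Cmod_ge_0 | exact Hy].
    + rewrite (S_INR (S n)). simpl (r ^ S n). right; ring.
Qed.

Lemma Cpow_lip_unit (x y : C) (n : nat) :
  Cmod x <= 1 -> Cmod y <= 1 ->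
  Cmod (x ^ n - y ^ n) <= INR n * Cmod (x - y).
Proof.
  intros Hx Hy. destruct n as [|n].
  - simpl. replace (1 - 1)%C with (RtoC 0) by ring. rewrite Cmod_0. lra.
  - pose proof (Cpow_lip 1 x y n Hx Hy) as H. rewrite pow1 in H. lra.
Qed.

(** * Size and Lipschitz bounds for the monomials |z|^m z^n *)

Definition monomial (m n : nat) (z : C) : C := (RtoC (Cmod z ^ m) * z ^ n)%C.

Lemma pow_le_1 (x : R) (n : nat) : 0 <= x <= 1 -> 0 <= x ^ n <= 1.
Proof.
  intros H. split; [apply pow_le; lra|].
  rewrite <- (pow1 n). apply pow_incr. exact H.
Qed.

Lemma Cmod_RtoC_pow (z : C) (m : nat) : Cmod (RtoC (Cmod z ^ m)) = Cmod z ^ m.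
Proof.
  rewrite Cmod_R. apply Rabs_pos_eq, pow_le, Cmod_ge_0.
Qed.

Lemma pow_SS_le_sqr (x r : R) (n : nat) :
  0 <= x <= r -> r <= 1 -> x ^ S (S n) <= r * r.
Proof.
  intros Hx Hr. pose proof (pow_le_1 x n ltac:(lra)). simpl. nra.
Qed.

(** Here |z|^m <= 1 and |z|^(n+2) <= r^2, while the total degree is at least 2, which pays for the
    factor 1/2. *)
Lemma Cmod_monomial_le (r : R) (m n : nat) (z : C) :
  r <= 1 -> Cmod z <= r ->
  Cmod (monomial m (S (S n)) z) <= INR (m + S (S n)) * (r * r / 2).
Proof.
  intros Hr Hz. pose proof (Cmod_ge_0 z) as H0.
  unfold monomial. rewrite Cmod_mult, Cmod_RtoC_pow, Cmod_pow.
  pose proof (pow_le_1 (Cmod z) m ltac:(lra)).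
  pose proof (pow_SS_le_sqr (Cmod z) r n ltac:(lra) Hr).
  pose proof (pow_le (Cmod z) (S (S n)) H0).
  rewrite plus_INR, !S_INR. pose proof (pos_INR m). pose proof (pos_INR n).
  assert (0 <= r * r) by nra.
  nra.
Qed.

(** By the product rule, the factor |z|^m contributes m |z - w| times |w|^(n+2) <= r, and the factor
    z^(n+2) contributes (n+2) r |z - w|; the two add up to the total degree. *)
Lemma monomial_lip (r : R) (m n : nat) (z w : C) :
  r <= 1 -> Cmod z <= r -> Cmod w <= r ->
  Cmod (monomial m (S (S n)) z - monomial m (S (S n)) w)
    <= INR (m + S (S n)) * (r * Cmod (z - w)).
Proof.
  intros Hr Hz Hw. pose proof (Cmod_ge_0 z) as Hz0. pose proof (Cmod_ge_0 w) as Hw0.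
  pose proof (Cmod_ge_0 (z - w)) as Hd.
  assert (Hpz : Cmod (RtoC (Cmod z ^ m)) <= 1)
    by (rewrite Cmod_RtoC_pow; apply pow_le_1; lra).
  assert (Hpw : Cmod (w ^ S (S n)) <= r)
    by (rewrite Cmod_pow; pose proof (pow_SS_le_sqr (Cmod w) r n ltac:(lra) Hr); nra).
  assert (Hm : Cmod (RtoC (Cmod z ^ m) - RtoC (Cmod w ^ m)) <= INR m * Cmod (z - w)).
  (* The power of the modulus is treated as a power of a complex number; the reverse triangle
     inequality then replaces | |z| - |w| | by |z - w|. *)
  { rewrite !RtoC_pow. eapply Rle_trans.
    - apply Cpow_lip_unit; rewrite Cmod_R, Rabs_pos_eq; lra.
    - apply Rmult_le_compat_l; [apply pos_INR|].
      rewrite <- RtoC_minus, Cmod_R. apply Rabs_Cmod_minus_le. }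
  assert (Hn : Cmod (z ^ S (S n) - w ^ S (S n)) <= INR (S (S n)) * r * Cmod (z - w)).
  { eapply Rle_trans; [apply (Cpow_lip r); assumption|].
    apply Rmult_le_compat_r; [exact Hd|].
    apply Rmult_le_compat_l; [apply pos_INR|].
    simpl. pose proof (pow_le_1 r n ltac:(lra)). nra. }
  unfold monomial. eapply Rle_trans.
  - apply Cmod_mult_lip; [exact Hpz | exact Hpw | exact Hm | exact Hn].
  - rewrite plus_INR. right; ring.
Qed.

(** * Modulus of finite sums and of series *)

Lemma Cmod_sum_n_m_le (u : nat -> C) (B : nat -> R) (n m : nat) :
  (forall k, (n <= k <= m)%nat -> Cmod (u k) <= B k) ->
  Cmod (sum_n_m u n m) <= sum_n_m B n m.
Proof.
  intros H.
  (* The maximum leaves [B] unchanged on the range of summation and dominates |u k| at every index,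
     as the comparison of sums requires. *)
  rewrite (sum_n_m_ext_loc B (fun k => Rmax (Cmod (u k)) (B k))).
  2: { intros k Hk. symmetry. apply Rmax_right, H, Hk. }
  eapply Rle_trans.
  - rewrite Cmod_norm. apply (norm_sum_n_m (V := C_R_NormedModule)).
  - apply sum_n_m_le. intros k. rewrite <- Cmod_norm. apply Rmax_l.
Qed.

Lemma sum_n_m_Cminus (u v : nat -> C) (n m : nat) :
  sum_n_m (fun k => (u k - v k)%C) n m = (sum_n_m u n m - sum_n_m v n m)%C.
Proof.
  assert (E : forall x y : C, (x - y + y)%C = x) by (intros; ring).
  assert (E' : forall x y : C, (x + y - y)%C = x) by (intros; ring).
  transitivity (sum_n_m (fun k => (u k - v k)%C) n m + sum_n_m v n m
                - sum_n_m v n m)%C.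
  - symmetry. apply E'.
  - f_equal. rewrite <- (sum_n_m_plus (G := C_AbelianMonoid)).
    apply sum_n_m_ext. intros k. apply E.
Qed.

Lemma sum_n_m_scal_le (K : R) (t : nat -> R) (n m : nat) :
  0 <= K -> sum_n_m t n m <= 1 -> sum_n_m (fun k => K * t k) n m <= K.
Proof.
  intros HK Ht. eapply Rle_trans.
  - right. apply (sum_n_m_mult_l (K := R_AbsRing) K t).
  - rewrite <- (Rmult_1_r K) at 2. apply Rmult_le_compat_l; assumption.
Qed.

(** The bound holds for partial sums and passes to the limit by continuity of the norm. *)
Lemma Cmod_is_series_le (u : nat -> C) (l : C) (B : nat -> R) (s : R) :
  is_series (K := C_AbsRing) (V := C_NormedModule) u l ->
  is_series B s -> (forall i, Cmod (u i) <= B i) -> Cmod l <= s.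
Proof.
  intros Hu HB Hle.
  assert (H : is_lim_seq (fun n => Cmod (sum_n u n)) (Cmod l)).
  { eapply filterlim_comp; [exact Hu|].
    apply (filterlim_norm (K := C_AbsRing) (V := C_NormedModule)). }
  refine (is_lim_seq_le _ (sum_n B) _ s _ H HB).
  intros n. apply Cmod_sum_n_m_le. auto.
Qed.

(** * Bounds for one analytic component without its linear term *)

Definition remainder (m : nat) (c : nat -> C) (h : C -> C) (z : C) : C :=
  (RtoC (Cmod z ^ m) * (h z - c 1%nat * z))%C.

Lemma is_series_remainder (m : nat) (c : nat -> C) (h : C -> C) (z : C) :
  power_expansion c h -> unit_disk z ->
  is_series (K := C_AbsRing) (V := C_NormedModule)
    (fun i => (c (S (S i)) * monomial m (S (S i)) z)%C) (remainder m c h z).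
Proof.
  intros Hc Hz. unfold remainder, monomial.
  assert (H := Hc z Hz).
  apply (is_series_ext (K := C_AbsRing) (V := C_NormedModule)
    (fun i => scal (RtoC (Cmod z ^ m)) (c (S (S i)) * z ^ S (S i))%C)).
  { intros i. change (RtoC (Cmod z ^ m) * (c (S (S i)) * z ^ S (S i)) =
      c (S (S i)) * (RtoC (Cmod z ^ m) * z ^ S (S i)))%C. ring. }
  apply (is_series_scal_l (K := C_AbsRing) (V := C_NormedModule)).
  apply (is_series_incr_1 (K := C_AbsRing) (V := C_NormedModule)
    (fun i => (c (S i) * z ^ S i)%C)).
  change (is_series (K := C_AbsRing) (V := C_NormedModule)
    (fun i => (c (S i) * z ^ S i)%C) (h z - c 1%nat * z + c 1%nat * z ^ 1)%C).
  replace (h z - c 1%nat * z + c 1%nat * z ^ 1)%C with (h z); [exact H|].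
  rewrite Cpow_1_r. ring.
Qed.

(** The part j >= 2 of the coefficient sum of one component; with m = 2(k-1) the weight is the total
    degree of the monomial. *)
Definition tail_weight (m : nat) (c : nat -> C) : R :=
  Series (fun i => INR (m + S (S i)) * Cmod (c (S (S i)))).

Section RemainderBounds.

Variables (m : nat) (c : nat -> C) (h : C -> C) (r : R).
Hypothesis (Hc : power_expansion c h).
Hypothesis (Hsum : ex_series (fun i => INR (m + S i) * Cmod (c (S i)))).
Hypothesis (Hr : r < 1).

(** Supplies the majorant series for both bounds below, with [x] equal to r^2/2 or to r |z - w|. *)
Lemma is_series_tail_weight (x : R) :
  is_series (fun i => x * (INR (m + S (S i)) * Cmod (c (S (S i)))))
    (x * tail_weight m c).
Proof.
  apply (is_series_scal_l (K := R_AbsRing) (V := R_NormedModule)).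
  apply Series_correct.
  apply (ex_series_incr_1 (fun i => INR (m + S i) * Cmod (c (S i)))), Hsum.
Qed.

Lemma Cmod_remainder_le (z : C) :
  Cmod z <= r -> Cmod (remainder m c h z) <= r * r / 2 * tail_weight m c.
Proof.
  intros Hz.
  eapply Cmod_is_series_le.
  - apply is_series_remainder; [exact Hc | unfold unit_disk; lra].
  - apply is_series_tail_weight.
  - intros i. cbn beta. rewrite Cmod_mult.
    pose proof (Cmod_monomial_le r m i z ltac:(lra) Hz).
    pose proof (Cmod_ge_0 (c (S (S i)))). nra.
Qed.

Lemma remainder_lip (z w : C) :
  Cmod z <= r -> Cmod w <= r ->
  Cmod (remainder m c h z - remainder m c h w)
    <= r * Cmod (z - w) * tail_weight m c.
Proof.
  intros Hz Hw.
  eapply Cmod_is_series_le.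
  - apply (is_series_minus (K := C_AbsRing) (V := C_NormedModule));
      apply is_series_remainder; try exact Hc; unfold unit_disk; lra.
  - apply is_series_tail_weight.
  - intros i. cbn beta.
    change (Cmod (c (S (S i)) * monomial m (S (S i)) z
                  - c (S (S i)) * monomial m (S (S i)) w)
      <= r * Cmod (z - w) * (INR (m + S (S i)) * Cmod (c (S (S i))))).
    replace (c (S (S i)) * monomial m (S (S i)) z
             - c (S (S i)) * monomial m (S (S i)) w)%C
      with (c (S (S i)) * (monomial m (S (S i)) z - monomial m (S (S i)) w))%C
      by ring.
    rewrite Cmod_mult.
    pose proof (monomial_lip r m i z w ltac:(lra) Hz Hw).
    pose proof (Cmod_ge_0 (c (S (S i)))). nra.
Qed.

End RemainderBounds.

(** * Splitting the coefficient condition *)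

Lemma ex_series_weight_split (m : nat) (a b : nat -> C) :
  ex_series (fun i => INR (m + S i) * (Cmod (a (S i)) + Cmod (b (S i)))) ->
  ex_series (fun i => INR (m + S i) * Cmod (a (S i))) /\
  ex_series (fun i => INR (m + S i) * Cmod (b (S i))).
Proof.
  intros H.
  split; apply (ex_series_le (V := R_CompleteNormedModule)) with (2 := H);
    intros i; change norm with Rabs;
    pose proof (pos_INR (m + S i)); pose proof (Cmod_ge_0 (a (S i)));
    pose proof (Cmod_ge_0 (b (S i)));
    rewrite Rabs_pos_eq; nra.
Qed.

(** Isolates the term j = 1, whose value is prescribed by the normalization of the class. *)
Lemma Series_weight_split (m : nat) (a b : nat -> C) :
  ex_series (fun i => INR (m + S i) * (Cmod (a (S i)) + Cmod (b (S i)))) ->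
  Series (fun i => INR (m + S i) * (Cmod (a (S i)) + Cmod (b (S i)))) =
  INR (m + 1) * (Cmod (a 1%nat) + Cmod (b 1%nat))
    + (tail_weight m a + tail_weight m b).
Proof.
  intros H. destruct (ex_series_weight_split m a b H) as [Ha Hb].
  rewrite (Series_incr_1 _ H). f_equal. unfold tail_weight.
  rewrite <- Series_plus.
  - apply Series_ext. intros i. ring.
  - apply (ex_series_incr_1 (fun i => INR (m + S i) * Cmod (a (S i)))), Ha.
  - apply (ex_series_incr_1 (fun i => INR (m + S i) * Cmod (b (S i)))), Hb.
Qed.

(** * Fixed points of contractions of a closed disk *)

(** The increments form a series dominated by a geometric one, and their partial sums telescope. *)
Lemma ex_lim_geom (x : nat -> R) (K q : R) :
  0 <= q < 1 -> (forall n, Rabs (x (S n) - x n) <= K * q ^ n) ->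
  exists l : R, is_lim_seq x l.
Proof.
  intros Hq H.
  destruct (ex_series_le (V := R_CompleteNormedModule)
    (fun n => x (S n) - x n) (fun n => K * q ^ n) H) as [l Hl].
  { apply (ex_series_scal_l (K := R_AbsRing) (V := R_NormedModule) K), ex_series_geom. rewrite Rabs_pos_eq; lra. }
  (* The sum of the increments up to index n reaches x (n+1), hence the shift. *)
  exists (x O + l). apply is_lim_seq_incr_1.
  apply is_lim_seq_ext with (fun n => x O + sum_n (fun n => x (S n) - x n) n).
  - intros n. induction n as [|n IH].
    + rewrite sum_O. ring.
    + rewrite sum_Sn. unfold plus; simpl. lra.
  - apply (is_lim_seq_plus' (fun _ => x O)); [apply is_lim_seq_const | exact Hl].
Qed.

(** Picard iteration from 0, with convergence obtained separately for real and imaginary parts. *)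
Lemma contraction_fixed_point (T : C -> C) (r q : R) :
  0 <= r -> 0 <= q < 1 ->
  (forall z, Cmod z <= r -> Cmod (T z) <= r) ->
  (forall z w, Cmod z <= r -> Cmod w <= r -> Cmod (T z - T w) <= q * Cmod (z - w)) ->
  exists z, Cmod z <= r /\ T z = z.
Proof.
  intros Hr Hq Hmap Hlip.
  set (x := fun n => Nat.iter n T (RtoC 0)).
  assert (Hx : forall n, Cmod (x n) <= r).
  { induction n as [|n IH]; [simpl; rewrite Cmod_0; lra | apply Hmap, IH]. }
  (* The first step has length at most r because the iteration starts at the centre. *)
  assert (Hstep : forall n, Cmod (x (S n) - x n) <= r * q ^ n).
  { induction n as [|n IH].
    - pose proof (Hx 1%nat). change (x O) with (RtoC 0).
      replace (x 1%nat - RtoC 0)%C with (x 1%nat) by ring.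
      rewrite pow_O. lra.
    - change (x (S (S n))) with (T (x (S n))). change (x (S n)) with (T (x n)) at 2.
      eapply Rle_trans; [apply Hlip; apply Hx|].
      cbn [pow]. nra. }
  destruct (ex_lim_geom (fun n => Re (x n)) r q Hq) as [lx Hlx].
  { intros n. eapply Rle_trans; [|apply Hstep].
    exact (re_le_Cmod (x (S n) - x n)). }
  destruct (ex_lim_geom (fun n => Im (x n)) r q Hq) as [ly Hly].
  { intros n. eapply Rle_trans; [|apply Hstep].
    eapply Rle_trans; [|apply Rmax_Cmod]. apply Rmax_r. }
  set (z := (lx, ly) : C).
  assert (Hlim : is_lim_seq (fun n => Cmod (x n - z)) 0).
  { assert (H2 : is_lim_seq (fun n => Rabs (Re (x n) - lx) + Rabs (Im (x n) - ly)) 0).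
    { replace (Finite 0) with (Finite (Rabs (lx - lx) + Rabs (ly - ly)))
        by (rewrite !Rminus_diag, Rabs_R0; f_equal; ring).
      apply is_lim_seq_plus'; apply (is_lim_seq_abs _ (Finite _));
        (apply is_lim_seq_minus'; [assumption | apply is_lim_seq_const]). }
    apply is_lim_seq_le_le with (u := fun _ => 0) (3 := H2);
      [|apply is_lim_seq_const].
    intros n. split; [apply Cmod_ge_0|].
    replace (x n - z)%C with (RtoC (Re (x n) - lx) + Ci * RtoC (Im (x n) - ly))%C
      by (unfold z; destruct (x n); apply injective_projections; simpl; ring).
    eapply Rle_trans; [apply Cmod_triangle|].
    rewrite Cmod_mult, Cmod_Ci, !Cmod_R. lra. }
  assert (Hz : Cmod z <= r).
  { refine (is_lim_seq_le (fun _ => Cmod z) (fun n => r + Cmod (x n - z)) (Cmod z) r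
      _ (is_lim_seq_const _) _).
    - intros n. pose proof (Rabs_Cmod_minus_le z (x n)) as H.
      rewrite Cmod_minus_sym in H. apply Rabs_le_between in H.
      pose proof (Hx n). lra.
    - replace (Finite r) with (Finite (r + 0)) by (f_equal; ring).
      apply is_lim_seq_plus'; [apply is_lim_seq_const | exact Hlim]. }
  exists z. split; [exact Hz|].
  (* Passing to the limit in |T z - z| <= |T z - T x_n| + |x_(n+1) - z| <= q |x_n - z| + |x_(n+1) -
     z|. *)
  assert (H0 : Cmod (T z - z) <= 0).
  { refine (is_lim_seq_le (fun _ => Cmod (T z - z))
      (fun n => q * Cmod (x n - z) + Cmod (x (S n) - z)) (Cmod (T z - z)) 0
      _ (is_lim_seq_const _) _).
    - intros n. eapply Rle_trans; [apply (Cmod_minus_triangle _ (x (S n)))|].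
      apply Rplus_le_compat_r. rewrite (Cmod_minus_sym (x n)).
      apply Hlip; [exact Hz | apply Hx].
    - replace (Finite 0) with (Finite (q * 0 + 0)) by (f_equal; ring).
      apply is_lim_seq_plus'.
      + apply (is_lim_seq_scal_l _ q 0), Hlim.
      + apply (is_lim_seq_incr_1 (fun n => Cmod (x n - z))), Hlim. }
  assert (E : (T z - z)%C = RtoC 0).
  { apply Cmod_eq_0. apply Rle_antisym; [exact H0 | apply Cmod_ge_0]. }
  replace (T z) with ((T z - z) + z)%C by ring. rewrite E. ring.
Qed.

(** * Solving F z = w in the disk *)

Theorem theorem1 (p : nat) (hp : (1 <= p)%nat)
    (a b : nat -> nat -> C) (F : C -> C) (hF : class_HC0 p a b F) :
  forall w : C, Cmod w < 1 / 2 -> exists z : C, unit_disk z /\ F z = w.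
Proof.
  destruct hF as [[[[_ [[h [g [Hexp HF]]] [Ha1 _]]] [Hb1 H2]] [Hconv Hsum]] _].
  cbn beta zeta in Hconv, Hsum.
  intros w Hw.
  set (r := 2 * Cmod w).
  pose proof (Cmod_ge_0 w) as Hw0.
  assert (Hr : 0 <= r < 1) by (unfold r; lra).
  set (m := fun k => (2 * (k - 1))%nat).
  set (v := fun k z => (remainder (m k) (a k) (h k) z
                        + Cconj (remainder (m k) (b k) (g k) z))%C).
  set (G := fun z => sum_n_m (fun k => v k z) 1 p : C).
  set (t := fun k => tail_weight (m k) (a k) + tail_weight (m k) (b k)).
  (* The terms j = 1 contribute exactly 1 for k = 1, since a_{1,1} = 1 and b_{1,1} = 0, and 0 for k
     >= 2; of the bound 2 there remains 1. *)
  assert (Ht : sum_n_m t 1 p <= 1).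
  { rewrite sum_Sn_m in Hsum by exact hp. rewrite sum_Sn_m by exact hp.
    rewrite (Series_weight_split (2 * (1 - 1)) (a 1%nat) (b 1%nat)) in Hsum
      by (apply Hconv; lia).
    rewrite (sum_n_m_ext_loc _ t 2 p) in Hsum.
    - rewrite Ha1, Hb1, Cmod_1, Cmod_0 in Hsum.
      unfold plus in *; simpl in Hsum |- *. unfold t at 1.
      change (m 1%nat) with 0%nat. lra.
    - intros k Hk. rewrite (Series_weight_split (2 * (k - 1)) (a k) (b k))
        by (apply Hconv; lia).
      destruct (H2 k Hk) as [-> ->]. rewrite Cmod_0.
      unfold t, m. refine (_ : @eq R _ _). ring. }
  (* The only linear term removed is a_{1,1} z = z; for k >= 2 each remainder is the full
     component. *)
  assert (HFG : forall z, unit_disk z -> F z = (z + G z)%C).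
  { intros z Hz. rewrite (HF z Hz). unfold G.
    rewrite !(sum_Sn_m _ 1 p hp).
    rewrite (sum_n_m_ext_loc _ (fun k => v k z) 2 p).
    - match goal with |- plus ?x ?s = _ =>
        change (x + s = z + (v 1%nat z + s))%C end.
      unfold v, remainder, m. rewrite Ha1, Hb1. simpl.
      rewrite Cmult_conj, !Cminus_conj, !Cmult_conj.
      replace (Cconj (RtoC 1)) with (RtoC 1)
        by (apply injective_projections; simpl; ring).
      replace (Cconj (RtoC 0)) with (RtoC 0)
        by (apply injective_projections; simpl; ring).
      ring.
    - intros k Hk. unfold v, remainder, m. destruct (H2 k Hk) as [-> ->].
      rewrite Cmult_conj.
      replace (Cconj (RtoC (Cmod z ^ (2 * (k - 1)))))
        with (RtoC (Cmod z ^ (2 * (k - 1))))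
        by (apply injective_projections; simpl; ring).
      replace (h k z - RtoC 0 * z)%C with (h k z) by ring.
      replace (g k z - RtoC 0 * z)%C with (g k z) by ring.
      refine (_ : @eq C _ _). ring. }
  assert (Hw_ab : forall k, (1 <= k <= p)%nat -> _ /\ _) by
    (intros k Hk; exact (ex_series_weight_split (m k) (a k) (b k) (Hconv k Hk))).
  assert (HGb : forall z, Cmod z <= r -> Cmod (G z) <= r * r / 2).
  { intros z Hz. eapply Rle_trans.
    - apply Cmod_sum_n_m_le with (B := fun k => r * r / 2 * t k).
      intros k Hk. destruct (Hexp k Hk) as [_ [Hh [_ Hg]]].
      destruct (Hw_ab k Hk) as [Ha Hb].
      eapply Rle_trans; [apply Cmod_triangle|]. rewrite Cmod_conj.
      pose proof (Cmod_remainder_le _ _ _ r Hh Ha (proj2 Hr) z Hz).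
      pose proof (Cmod_remainder_le _ _ _ r Hg Hb (proj2 Hr) z Hz).
      unfold t. lra.
    - apply sum_n_m_scal_le; [nra | exact Ht]. }
  assert (HGl : forall x y, Cmod x <= r -> Cmod y <= r ->
    Cmod (G x - G y) <= r * Cmod (x - y)).
  { intros x y Hx Hy. pose proof (Cmod_ge_0 (x - y)) as Hd.
    replace (G x - G y)%C with (sum_n_m (fun k => (v k x - v k y)%C) 1 p).
    2: apply sum_n_m_Cminus.
    eapply Rle_trans.
    - apply Cmod_sum_n_m_le with (B := fun k => r * Cmod (x - y) * t k).
      intros k Hk. destruct (Hexp k Hk) as [_ [Hh [_ Hg]]].
      destruct (Hw_ab k Hk) as [Ha Hb].
      unfold v.
      (* Regrouped so that each remainder is compared with itself at the two points; conjugation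
         preserves the modulus. *)
      match goal with |- Cmod (?p + Cconj ?q - (?p' + Cconj ?q')) <= _ =>
        replace (p + Cconj q - (p' + Cconj q'))%C
          with ((p - p') + Cconj (q - q'))%C by (rewrite Cminus_conj; ring) end.
      eapply Rle_trans; [apply Cmod_triangle|]. rewrite Cmod_conj.
      pose proof (remainder_lip _ _ _ r Hh Ha (proj2 Hr) x y Hx Hy).
      pose proof (remainder_lip _ _ _ r Hg Hb (proj2 Hr) x y Hx Hy).
      unfold t. lra.
    - apply sum_n_m_scal_le; [nra | exact Ht]. }
  destruct (contraction_fixed_point (fun z => w - G z)%C r r) as [z [Hz Ez]].
  - lra.
  - exact Hr.
  - intros z Hz. eapply Rle_trans; [apply Cmod_triangle|]. rewrite Cmod_opp.
    pose proof (HGb z Hz). unfold r in *. nra.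
  - intros x y Hx Hy.
    replace (w - G x - (w - G y))%C with (G y - G x)%C by ring.
    rewrite (Cmod_minus_sym x y). apply HGl; assumption.
  - assert (Hu : unit_disk z) by (unfold unit_disk; lra).
    exists z. split; [exact Hu|].
    rewrite (HFG z Hu), <- Ez at 1. ring.
Qed.
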